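(* Let $\mathcal{H}$ be a Hilbert space of dimension $d=2$ and take $\mathcal{H}_{\text{anc}}=\mathcal{H}_{\text{in}}=\mathcal{H}_{\text{out}}=\mathcal{H}$. For $l\in\{1,2\}$ let $\{\ket{\Psi^{(l)}_i}\}_{i=0}^{d^2-1}$ be a maximally entangled basis of $\mathcal{H}\otimes\mathcal{H}$, let $\Omega_l=\{x^{(l)}_0,\dots,x^{(l)}_{d^2-1}\}$ be outcome sets with $\Omega_1\cap\Omega_2=\emptyset$, let $\mathsf{E}^{(l)}$ be the POVM with elements $\mathsf{E}^{(l)}(x^{(l)}_i)=\ket{\Psi^{(l)}_i}\bra{\Psi^{(l)}_i}$, and let $\mathsf{T}^{(l)}(x^{(l)}_i)=(\Upsilon^{*}_{P_+}\otimes\mathcal{I}_{\text{out}})(\mathsf{E}^{(l)}(x^{(l)}_i))$ be the elements of the tester associated with the maximally entangled input state $P_+$ and $\mathsf{E}^{(l)}$. Put $$c(x^{(1)}_i,x^{(2)}_j)=\max_{\Lambda}\left\{\tfrac12\mathrm{tr}\left[\mathsf{T}^{(1)}(x^{(1)}_i)J_\Lambda\right]+\tfrac12\mathrm{tr}\left[\mathsf{T}^{(2)}(x^{(2)}_j)J_\Lambda\right]\right\},$$ the maximum being over all quantum channels $\Lambda$ from $\mathcal{L}(\mathcal{H}_{\text{in}})$ to $\mathcal{L}(\mathcal{H}_{\text{out}})$, where $J_\Lambda$ is the Choi operator of $\Lambda$. Then for all $i,j\in\{0,\dots,d^2-1\}$, $$c(x^{(1)}_i,x^{(2)}_j)=\frac12\left(1+\left|\braket{\Psi^{(1)}_i|\Psi^{(2)}_j}\right|\right),$$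 and the maximum is achieved by the unitary channel $\Lambda_{x^{(1)}_i,x^{(2)}_j}(\cdot)=U_{x^{(1)}_i,x^{(2)}_j}(\cdot)U_{x^{(1)}_i,x^{(2)}_j}^{\dagger}$, where $$U_{x^{(1)}_i,x^{(2)}_j}=\begin{cases}\dfrac{1}{\sqrt{2+\left|\braket{U^{(1)}_i|U^{(2)}_j}_{\text{HS}}\right|}}\left(U^{(1)}_i+\dfrac{\braket{U^{(2)}_j|U^{(1)}_i}_{\text{HS}}}{\left|\braket{U^{(1)}_i|U^{(2)}_j}_{\text{HS}}\right|}U^{(2)}_j\right)&\text{if }\braket{U^{(1)}_i|U^{(2)}_j}_{\text{HS}}\neq0,\\[2ex]U^{(1)}_i&\text{if }\braket{U^{(1)}_i|U^{(2)}_j}_{\text{HS}}=0.\end{cases}$$ Here $U^{(1)}_i$ and $U^{(2)}_j$ are the unitary operators on $\mathcal{H}$ given by $\ket{\Psi^{(1)}_i}=(I\otimes U^{(1)}_i)\ket{\Psi_+}$ and $\ket{\Psi^{(2)}_j}=(I\otimes U^{(2)}_j)\ket{\Psi_+}$, and $\braket{A|B}_{\text{HS}}=\mathrm{tr}[A^\dagger B]$ is the Hilbert--Schmidt inner product. (In particular $U_{x^{(1)}_i,x^{(2)}_j}$ is unitary.)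
   Context: Hilbert spaces are finite-dimensional (complex). $\mathcal{L}(\mathcal{H})$ is the set of linear operators on $\mathcal{H}$; $\mathcal{I}_\bullet$ is the identity map on $\mathcal{L}(\mathcal{H}_\bullet)$. A POVM is a finite family of positive operators summing to the identity. A quantum channel is a completely positive trace-preserving linear map. Fix an orthonormal basis $\{\ket{i}\}_{i=0}^{d-1}$ of $\mathcal{H}$. Put $P'_+=\sum_{i,j=0}^{d-1}\ket{i}\bra{j}\otimes\ket{i}\bra{j}$ and $P_+=P'_+/d$, a state (positive operator of trace $1$) on $\mathcal{H}_{\text{anc}}\otimes\mathcal{H}_{\text{in}}=\mathcal{H}\otimes\mathcal{H}$. The Choi operator of a channel $\Lambda$ is $J_\Lambda=(\mathcal{I}_{\text{in}}\otimes\Lambda)(P'_+)$. Write $\ket{\Psi_+}=\frac{1}{\sqrt d}\sum_{i=0}^{d-1}\ket{i\otimes i}$. A unit vector of $\mathcal{H}\otimes\mathcal{H}$ is maximally entangled if it has the form $(I\otimes U)\ket{\Psi_+}$ with $U$ unitary on $\mathcal{H}$ (such $U$ is unique); a maximally entangled basis (MEB) of $\mathcal{H}\otimes\mathcal{H}$ is an orthonormal basis consisting of maximally entangled vectors. For a state $\rho$ on $\mathcal{H}_{\text{anc}}\otimes\mathcal{H}_{\text{in}}$, $\Upsilon_\rho:\mathcal{L}(\mathcal{H}_{\text{in}})\to\mathcal{L}(\mathcal{H}_{\text{anc}})$ is the completely positive map determined by $\rho=(\Upsilon_\rho\otimes\mathcal{I}_{\text{in}})(P'_+)$, and $\Upsilon_\rho^{*}$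 is its dual: $\mathrm{tr}[A^\dagger\Upsilon_\rho(B)]=\mathrm{tr}[\Upsilon_\rho^{*}(A)^\dagger B]$ for all $A\in\mathcal{L}(\mathcal{H}_{\text{anc}})$, $B\in\mathcal{L}(\mathcal{H}_{\text{in}})$. For $\rho=P_+$ one has $\Upsilon_{P_+}^{*}=\frac1d\,\mathcal{I}$, so that $\mathsf{T}^{(l)}(x^{(l)}_i)=\frac1d\ket{\Psi^{(l)}_i}\bra{\Psi^{(l)}_i}$. *)

(* Defs.v *)
(* A Hilbert space of dimension d is 'cV[C]_d, the fixed orthonormal basis being
   the standard one; operators on it are 'M[C]_d. C stands for R[i], R a realType. *)
From HB Require Import structures.
From mathcomp Require Import all_boot all_order all_algebra.
From mathcomp Require Import sesquilinear spectral mxtens.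
Set Implicit Arguments.
Unset Strict Implicit.
Unset Printing Implicit Defensive.
Import GRing.Theory Num.Theory.
Local Open Scope ring_scope.

Section Quantum.
Variable C : numClosedFieldType.

Definition adjmx m n (A : 'M[C]_(m, n)) : 'M[C]_(n, m) := map_mx Num.conj A^T.

(* Conjugate-linear in the first argument, as is hs below. *)
Definition braket n (u v : 'cV[C]_n) : C := (adjmx u *m v) 0 0.

Definition ketbra m n (u : 'cV[C]_m) (v : 'cV[C]_n) : 'M[C]_(m, n) :=
  u *m adjmx v.

Definition hs n (A B : 'M[C]_n) : C := \tr (adjmx A *m B).

Definition ket d (i : 'I_d) : 'cV[C]_d := delta_mx i 0.

(* The type of u *t v is 'M_(m * n, 1 * 1), which is convertible to 'cV_(m * n). *)
Definition tensv m n (u : 'cV[C]_m) (v : 'cV[C]_n) : 'cV[C]_(m * n) := u *t v.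

(* In C, 0 <= z means that z is real and nonnegative. *)
Definition positive_op n (A : 'M[C]_n) : Prop :=
  forall v : 'cV[C]_n, 0 <= braket v (A *m v).

(* F (x) G on L(C^m (x) C^p): the linear extension of
   E_ij (x) E_kl |-> F E_ij (x) G E_kl, with E_ij the matrix units. *)
Definition tensmap m n p q (F : {linear 'M[C]_m -> 'M[C]_n})
    (G : {linear 'M[C]_p -> 'M[C]_q}) (X : 'M[C]_(m * p)) : 'M[C]_(n * q) :=
  \sum_(i < m) \sum_(j < m) \sum_(k < p) \sum_(l < p)
    X (mxtens_index (i, k)) (mxtens_index (j, l))
      *: (F (delta_mx i j) *t G (delta_mx k l)).

Definition idmap n : {linear 'M[C]_n -> 'M[C]_n} := idfun.

Definition completely_positive m n (L : {linear 'M[C]_m -> 'M[C]_n}) : Prop :=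
  forall (k : nat) (X : 'M[C]_(k * m)),
    positive_op X -> positive_op (tensmap (idmap k) L X).

Definition trace_preserving m n (L : {linear 'M[C]_m -> 'M[C]_n}) : Prop :=
  forall X : 'M[C]_m, \tr (L X) = \tr X.

Definition is_channel m n (L : {linear 'M[C]_m -> 'M[C]_n}) : Prop :=
  completely_positive L /\ trace_preserving L.

Definition conj_map n (U : 'M[C]_n) : {linear 'M[C]_n -> 'M[C]_n} :=
  mulmxr (adjmx U) \o mulmx U.

(* The sum runs over the outcome set Om; the values of E outside of Om are
   irrelevant. *)
Definition is_povm (X : finType) (Om : {set X}) n (E : X -> 'M[C]_n) : Prop :=
  (forall x, x \in Om -> positive_op (E x)) /\ \sum_(x in Om) E x = 1%:M.

Definition Pplus' d : 'M[C]_(d * d) :=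
  \sum_(i < d) \sum_(j < d) ketbra (ket i) (ket j) *t ketbra (ket i) (ket j).

Definition Pplus d : 'M[C]_(d * d) := d%:R^-1 *: Pplus' d.

Definition choi m n (L : {linear 'M[C]_m -> 'M[C]_n}) : 'M[C]_(m * n) :=
  tensmap (idmap m) L (Pplus' m).

Definition Psi_plus d : 'cV[C]_(d * d) :=
  (sqrtC d%:R)^-1 *: \sum_(i < d) tensv (ket i) (ket i).

Definition max_entangled_by d (U : 'M[C]_d) (v : 'cV[C]_(d * d)) : Prop :=
  U \is unitarymx /\ v = (1%:M *t U) *m Psi_plus d.

Definition orthonormal_basis n k (e : 'I_k -> 'cV[C]_n) : Prop :=
  (forall i j, braket (e i) (e j) = (i == j)%:R) /\ basis_of fullv (codom e).

Definition is_MEB d (Psi : 'I_(d ^ 2) -> 'cV[C]_(d * d)) : Prop :=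
  orthonormal_basis Psi /\ forall i, exists U, max_entangled_by U (Psi i).

(* Ups = Upsilon_rho: L(H_in) -> L(H_anc), the completely positive map with
   rho = (Upsilon_rho (x) id_in)(P'_+). *)
Definition is_Upsilon m d (rho : 'M[C]_(m * d))
    (Ups : {linear 'M[C]_d -> 'M[C]_m}) : Prop :=
  completely_positive Ups /\ rho = tensmap Ups (idmap d) (Pplus' d).

Definition is_dual m n (F : {linear 'M[C]_m -> 'M[C]_n})
    (Fdual : {linear 'M[C]_n -> 'M[C]_m}) : Prop :=
  forall (A : 'M[C]_n) (B : 'M[C]_m), hs A (F B) = hs (Fdual A) B.

(* The element at outcome x of the tester of (rho, E), where Upsdual is the dual
   of Upsilon_rho and E is a POVM on H_anc (x) H_out. *)
Definition tester (X : finType) m d n (Upsdual : {linear 'M[C]_m -> 'M[C]_d})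
    (E : X -> 'M[C]_(m * n)) (x : X) : 'M[C]_(d * n) :=
  tensmap Upsdual (idmap n) (E x).

Definition avg_prob m n (T1 T2 : 'M[C]_(m * n))
    (L : {linear 'M[C]_m -> 'M[C]_n}) : C :=
  2^-1 * \tr (T1 *m choi L) + 2^-1 * \tr (T2 *m choi L).

Definition is_maximum (I : Type) (P : I -> Prop) (f : I -> C) (c : C) : Prop :=
  (exists x, P x /\ f x = c) /\ (forall x, P x -> f x <= c).

(* The normalisation is specific to dimension 2, where hs U U = 2 for U unitary. *)
Definition optimal_unitary (U1 U2 : 'M[C]_2) : 'M[C]_2 :=
  if hs U1 U2 == 0 then U1
  else (sqrtC (2 + `|hs U1 U2|))^-1 *: (U1 + (hs U2 U1 / `|hs U1 U2|) *: U2).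

End Quantum.

Arguments ket {C d} i.
Arguments idmap {C} n.
Arguments Pplus' {C} d.
Arguments Pplus {C} d.
Arguments Psi_plus {C} d.

(* Main.v *)
(* Since [Upsilon] is [d^-1] times the identity, [c] is the maximum of
   [(<Psi1|J|Psi1> + <Psi2|J|Psi2>) / 2d] over Choi operators [J], which are
   positive of trace [d].  As the largest eigenvalue of
   [|u><u| + |v><v|] is [1 + |<u|v>|] for unit vectors, this is at most
   [(1 + |<Psi1|Psi2>|) / 2], with equality when [J] is supported on the line
   spanned by the sum of the phase-aligned vectors.  That sum corresponds to the
   operator [U1 + w U2] with [|w| = 1] and [<U1|w U2>] real positive, which in
   dimension 2 is a multiple of a unitary because a 2x2 unitary [W] with real
   nonzero trace satisfies [W + W^* = \tr W]. *)
Require Import Defs.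
From mathcomp Require Import all_boot all_order all_algebra.
From mathcomp Require Import reals spectral mxtens complex ring.
Set Implicit Arguments.
Unset Strict Implicit.
Unset Printing Implicit Defensive.
Import Order.TTheory GRing.Theory Num.Theory.
Local Open Scope ring_scope.

Section Operators.
Variable C : numClosedFieldType.

(** * Adjoints, unitaries and traces *)

Lemma adjmxE m n (A : 'M[C]_(m, n)) i j : adjmx A i j = (A j i)^*.
Proof. by rewrite !mxE. Qed.

Lemma adjmxK m n (A : 'M[C]_(m, n)) : adjmx (adjmx A) = A.
Proof. by apply/matrixP => i j; rewrite !mxE conjCK. Qed.

Lemma adjmxM m n p (A : 'M[C]_(m, n)) (B : 'M_(n, p)) :
  adjmx (A *m B) = adjmx B *m adjmx A.
Proof. by rewrite /adjmx trmx_mul map_mxM. Qed.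

Lemma adjmxD m n (A B : 'M[C]_(m, n)) : adjmx (A + B) = adjmx A + adjmx B.
Proof. by rewrite /adjmx linearD map_mxD. Qed.

Lemma adjmxZ m n k (A : 'M[C]_(m, n)) : adjmx (k *: A) = k^* *: adjmx A.
Proof. by rewrite /adjmx linearZ map_mxZ. Qed.

Lemma adjmx1 n : adjmx (1%:M : 'M[C]_n) = 1%:M.
Proof. by rewrite /adjmx trmx1 map_mx1. Qed.

Lemma adjmx_sum m n I (r : seq I) (P : pred I) (F : I -> 'M[C]_(m, n)) :
  adjmx (\sum_(i <- r | P i) F i) = \sum_(i <- r | P i) adjmx (F i).
Proof. by rewrite /adjmx raddf_sum raddf_sum. Qed.

Lemma adjmx_tens m n p q (A : 'M[C]_(m, n)) (B : 'M_(p, q)) :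
  adjmx (A *t B) = adjmx A *t adjmx B.
Proof. by rewrite /adjmx trmx_tens map_mxT. Qed.

Lemma unitaryP n {U : 'M[C]_n} :
  reflect (U *m adjmx U = 1%:M) (U \is unitarymx).
Proof. exact: unitarymxP. Qed.

Lemma unitary_adjmxM n (U : 'M[C]_n) : U \is unitarymx -> adjmx U *m U = 1%:M.
Proof. by move/unitaryP/mulmx1C. Qed.

Lemma mxtrace_adjmx n (A : 'M[C]_n) : \tr (adjmx A) = (\tr A)^*.
Proof. by rewrite /mxtrace rmorph_sum; apply: eq_bigr => i _; rewrite !mxE. Qed.

Lemma mxtrace_tens m n (A : 'M[C]_m) (B : 'M[C]_n) :
  \tr (A *t B) = \tr A * \tr B.
Proof. by rewrite /mxtrace mulr_sum; apply: eq_bigr => i _; rewrite mxE. Qed.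

(** * The inner product on column vectors and rank-one operators *)

Section Braket.
Variable n : nat.
Implicit Types (u v w : 'cV[C]_n) (A : 'M[C]_n).

Lemma braketDr u v w : braket u (v + w) = braket u v + braket u w.
Proof. by rewrite /braket mulmxDr mxE. Qed.

Lemma braketDl u v w : braket (v + w) u = braket v u + braket w u.
Proof. by rewrite /braket adjmxD mulmxDl mxE. Qed.

Lemma braketZr k u v : braket u (k *: v) = k * braket u v.
Proof. by rewrite /braket -scalemxAr mxE. Qed.

Lemma braketZl k u v : braket (k *: u) v = k^* * braket u v.
Proof. by rewrite /braket adjmxZ -scalemxAl mxE. Qed.

Lemma braketNr u v : braket u (- v) = - braket u v.
Proof. by rewrite -scaleN1r braketZr mulN1r. Qed.

Lemma braketNl u v : braket (- u) v = - braket u v.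
Proof. by rewrite -scaleN1r braketZl rmorphN1 mulN1r. Qed.

Lemma braket_conj u v : (braket u v)^* = braket v u.
Proof.
have -> : braket v u = adjmx (adjmx u *m v) 0 0 by rewrite adjmxM adjmxK.
by rewrite [RHS]mxE mxE.
Qed.

Lemma mul_ketbra u v w : ketbra u v *m w = braket v w *: u.
Proof.
by rewrite /ketbra -mulmxA [adjmx v *m w]mx11_scalar mul_mx_scalar.
Qed.

Lemma adjmx_ketbra u v : adjmx (ketbra u v) = ketbra v u.
Proof. by rewrite /ketbra adjmxM adjmxK. Qed.

Lemma braket_adjmx A u v : braket u (A *m v) = braket (adjmx A *m u) v.
Proof. by rewrite /braket adjmxM adjmxK mulmxA. Qed.

Lemma mxtrace_ketbraM u v A : \tr (ketbra u v *m A) = braket v (A *m u).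
Proof. by rewrite /ketbra -mulmxA mxtrace_mulC -mulmxA trace_mx11. Qed.

Lemma braket_ge0 u : 0 <= braket u u.
Proof.
by rewrite /braket mxE sumr_ge0 // => i _; rewrite !mxE mulrC mul_conjC_ge0.
Qed.

Lemma braket_eq0 u : (braket u u == 0) = (u == 0).
Proof.
apply/eqP/eqP => [|->]; last by rewrite -(scale0r 0) braketZr mul0r.
rewrite /braket mxE => /eqP; rewrite psumr_eq0 => [/allP u0|i _]; last first.
  by rewrite !mxE mulrC mul_conjC_ge0.
apply/colP => i; have := u0 i (mem_index_enum _).
by rewrite !mxE mulrC mul_conjC_eq0 => /eqP.
Qed.

Lemma positive_trace_ge0 A : positive_op A -> 0 <= \tr A.
Proof.
move=> A_ge0; apply: sumr_ge0 => i _; have := A_ge0 (ket i).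
suff -> : braket (ket i) (A *m ket i) = A i i by [].
by rewrite /braket /ket -colE mxE (bigD1 i) //= big1 ?addr0 => [|k ki];
  rewrite !mxE ?(negPf ki) ?eqxx /= ?rmorph0 ?rmorph1 ?mul0r ?mul1r.
Qed.

End Braket.

(** * Positive operators and the two-vector trace bound *)

Lemma positive_conj m n (A : 'M[C]_m) (B : 'M[C]_(m, n)) :
  positive_op A -> positive_op (adjmx B *m A *m B).
Proof.
move=> A_ge0 v; have := A_ge0 (B *m v).
by rewrite /braket adjmxM !mulmxA.
Qed.

Lemma positive_ketbra n (u : 'cV[C]_n) : positive_op (ketbra u u).
Proof.
by move=> v; rewrite mul_ketbra braketZr -[braket v u]braket_conj mul_conjC_ge0.
Qed.

(* Compressing [J] by the projection [Q] orthogonal to [a] removes exactly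
   [braket a (J *m a)] from the trace. *)
Lemma deflation n (J : 'M[C]_n) (a : 'cV[C]_n) :
  positive_op J -> braket a a = 1 ->
  exists2 K, positive_op K /\ \tr K = \tr J - braket a (J *m a) &
    forall z, braket a z = 0 -> braket z (K *m z) = braket z (J *m z).
Proof.
move=> J_ge0 a1; pose Q : 'M[C]_n := 1%:M - ketbra a a.
have Qadj : adjmx Q = Q.
  by rewrite /Q adjmxD adjmx1 -scaleN1r adjmxZ adjmx_ketbra rmorphN1.
have Qz z : Q *m z = z - braket a z *: a by rewrite mulmxBl mul1mx mul_ketbra.
have QQ : Q *m Q = Q.
  rewrite {2}/Q mulmxBr mulmx1 {1}/ketbra mulmxA Qz a1 scale1r subrr mul0mx.
  by rewrite subr0.
exists (adjmx Q *m J *m Q).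
  split; first exact: positive_conj.
  rewrite mxtrace_mulC mulmxA Qadj QQ mulmxBl mul1mx linearB /=.
  by rewrite mxtrace_ketbraM.
move=> z az0; rewrite -mulmxA Qz az0 scale0r subr0 -mulmxA.
by rewrite braket_adjmx adjmxK Qz az0 scale0r subr0.
Qed.

(** After normalising [z], deflation along it leaves a positive operator, whose trace, the trace of
    [J] minus the expectation of [J] in the normalised vector, is nonnegative. *)
Lemma braket_le_trace n (J : 'M[C]_n) (z : 'cV[C]_n) :
  positive_op J -> braket z (J *m z) <= braket z z * \tr J.
Proof.
move=> J_ge0; have [->|z0] := eqVneq z 0.
  by rewrite mulmx0 -(scale0r 0) !braketZr !mul0r.
have zz_gt0 : 0 < braket z z by rewrite lt_def braket_eq0 z0 braket_ge0.
pose k := (sqrtC (braket z z))^-1.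
have k_ge0 : 0 <= k by rewrite invr_ge0 sqrtC_ge0 ltW.
have kk : k * k * braket z z = 1.
  by rewrite -expr2 exprVn sqrtCK mulVf // gt_eqF.
have kJ u : braket (k *: z) (k *: u) = k * k * braket z u.
  by rewrite braketZl braketZr geC0_conj // mulrA.
have [|K [/positive_trace_ge0 K_ge0 Ktr] _] := @deflation n J (k *: z) J_ge0.
  by rewrite kJ.
move: K_ge0; rewrite Ktr subr_ge0 -scalemxAr kJ => /(ler_wpM2l (ltW zz_gt0)).
by rewrite mulrA [_ * (k * k)]mulrC kk mul1r.
Qed.

(* With [a] proportional to [u + v] and [z = u - v] orthogonal to it, the left
   side is [(1 + s) <a|J|a> + <z|J|z> / 2]; deflating [J] along [a] bounds the
   second term by [(1 - s) (\tr J - <a|J|a>)]. *)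
Lemma braket_pair_le_aligned n (J : 'M[C]_n) (u v : 'cV[C]_n) :
  positive_op J -> braket u u = 1 -> braket v v = 1 -> 0 <= braket u v ->
  braket u (J *m u) + braket v (J *m v) <= (1 + braket u v) * \tr J.
Proof.
move=> J_ge0 u1 v1 s_ge0; set s := braket u v.
have vu : braket v u = s by rewrite -braket_conj geC0_conj.
have s1_gt0 : 0 < 2 * (1 + s) by rewrite mulr_gt0 // ltr_pwDl.
pose k := (sqrtC (2 * (1 + s)))^-1.
have k_ge0 : 0 <= k by rewrite invr_ge0 sqrtC_ge0 ltW.
have kk : k * k * (2 * (1 + s)) = 1.
  by rewrite -expr2 exprVn sqrtCK mulVf // gt_eqF.
pose a := k *: (u + v); pose z := u - v.
have aJ w : braket a (k *: w) = k * k * braket (u + v) w.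
  by rewrite braketZl braketZr geC0_conj // mulrA.
have a1 : braket a a = 1.
  rewrite aJ !(braketDl, braketDr) u1 v1 vu -/s -[RHS]kk; ring.
have az : braket a z = 0.
  rewrite braketZl braketDl !braketDr !braketNr u1 v1 vu -/s; ring.
have zz : braket z z = 2 * (1 - s).
  rewrite !(braketDl, braketDr, braketNl, braketNr) u1 v1 vu -/s; ring.
have [K [K_ge0 trK] KJ] := deflation J_ge0 a1.
set p := braket a (J *m a) in trK.
have tp_ge0 : 0 <= \tr J - p by rewrite -trK positive_trace_ge0.
have := braket_le_trace z K_ge0; rewrite (KJ _ az) trK zz -subr_ge0 => q_le.
have par : 2 * (braket u (J *m u) + braket v (J *m v)) =
    2 * (1 + s) * p + braket z (J *m z).
  rewrite /p -scalemxAr aJ mulrA [_ * (k * k)]mulrC kk mul1r !mulmxDr mulmxN.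
  rewrite !(braketDl, braketDr, braketNl, braketNr); ring.
rewrite -(ler_pM2l (ltr0n _ 2)) par -subr_ge0.
(* The deflated term is bounded with factor [1 - s], while the target offers [1 + s]; the difference
   is the last summand, nonnegative because [s] is. *)
have -> : 2 * ((1 + s) * \tr J) - (2 * (1 + s) * p + braket z (J *m z)) =
    (2 * (1 - s) * (\tr J - p) - braket z (J *m z)) + 4 * (s * (\tr J - p)).
  ring.
by rewrite addr_ge0 // mulr_ge0 // mulr_ge0.
Qed.

(** Multiplying [v] by a phase leaves its expectation of [J] unchanged, so the overlap may be
    assumed real and nonnegative. *)
Lemma braket_pair_le n (J : 'M[C]_n) (u v : 'cV[C]_n) :
  positive_op J -> braket u u = 1 -> braket v v = 1 ->
  braket u (J *m u) + braket v (J *m v) <= (1 + `|braket u v|) * \tr J.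
Proof.
move=> J_ge0 u1 v1; set s := braket u v.
have [k kk ks] : exists2 k, k^* * k = 1 & k * s = `|s|.
  have [->|s0] := eqVneq s 0; first by exists 1; rewrite ?rmorph1 ?mul1r ?normr0.
  have ns0 : `|s| != 0 by rewrite normr_eq0.
  (* The phase opposite to that of [s]; when [s] vanishes any phase works, and 1 was taken. *)
  exists (s^* / `|s|); last first.
    by rewrite mulrAC [s^* * s]mulrC -normCK expr2 mulfK.
  rewrite rmorphM /= conjCK fmorphV /= (geC0_conj (normr_ge0 _)).
  by rewrite mulf_div -normCK -expr2 divff // expf_neq0.
have := @braket_pair_le_aligned n J u (k *: v) J_ge0 u1.
rewrite -scalemxAr !(braketZl, braketZr) v1 mulr1 kk -/s ks mulrA.
by rewrite [k^* * k]kk mul1r; apply.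
Qed.

(** * Matrix units, tensor products of maps and the trace of a Choi operator *)

Lemma delta_tens m n p q (i : 'I_m) (j : 'I_n) (k : 'I_p) (l : 'I_q) :
  delta_mx i j *t delta_mx k l =
    delta_mx (mxtens_index (i, k)) (mxtens_index (j, l)) :> 'M[C]_(_, _).
Proof.
apply/matrixP => a b.
case: (mxtens_indexP a) => a1 a2; case: (mxtens_indexP b) => b1 b2.
rewrite tensmxE !mxE !(can_eq (@mxtens_indexK _ _)) !xpair_eqE -natrM mulnb.
by rewrite andbACA.
Qed.

Lemma sum_mxtens (V : nmodType) m n (F : 'I_(m * n) -> V) :
  \sum_a F a = \sum_i \sum_j F (mxtens_index (i, j)).
Proof.
rewrite pair_bigA /= (reindex (@mxtens_index m n)); first by apply: eq_bigr => -[].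
by exists (@mxtens_unindex m n) => a _; rewrite (mxtens_indexK, mxtens_unindexK).
Qed.

(** The sums come in the order used by [tensmap], so identities about [tensmap] can be proved term
    by term. *)
Lemma mx_sum_delta_tens m n (X : 'M[C]_(m * n)) :
  X = \sum_(i < m) \sum_(j < m) \sum_(k < n) \sum_(l < n)
    X (mxtens_index (i, k)) (mxtens_index (j, l))
      *: (delta_mx i j *t delta_mx k l).
Proof.
pose F a b := X a b *: delta_mx a b.
transitivity (\sum_(i < m) \sum_(k < n) \sum_(j < m) \sum_(l < n)
    F (mxtens_index (i, k)) (mxtens_index (j, l))).
  rewrite {1}[X]matrix_sum_delta sum_mxtens; apply: eq_bigr => i _.
  by apply: eq_bigr => k _; rewrite sum_mxtens.
apply: eq_bigr => i _; rewrite exchange_big; apply: eq_bigr => j _.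
by apply: eq_bigr => k _; apply: eq_bigr => l _; rewrite delta_tens.
Qed.

Lemma tensmap_scale d n k (F : {linear 'M[C]_d -> 'M[C]_d}) (X : 'M[C]_(d * n)) :
  (forall A, F A = k *: A) -> tensmap F (idmap n) X = k *: X.
Proof.
move=> Fk; rewrite {2}[X]mx_sum_delta_tens /tensmap.
do 4![rewrite ?scaler_sumr; apply: eq_bigr => ? _].
rewrite Fk scalerA mulrC -scalerA; congr (_ *: _).
by apply/matrixP => a b; rewrite !mxE mulrA.
Qed.

Lemma tensmap_conj k n (U : 'M[C]_n) (X : 'M[C]_(k * n)) :
  tensmap (idmap k) (conj_map U) X = (1%:M *t U) *m X *m adjmx (1%:M *t U).
Proof.
rewrite {2}[X]mx_sum_delta_tens /tensmap.
do 4![rewrite ?mulmx_sumr ?mulmx_suml; apply: eq_bigr => ? _].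
by rewrite -scalemxAr -scalemxAl adjmx_tens adjmx1 !tensmx_mul mul1mx mulmx1.
Qed.

Lemma ketbra_ket d (i j : 'I_d) : ketbra (ket i) (ket j) = delta_mx i j :> 'M[C]_d.
Proof.
by rewrite /ketbra /adjmx /ket trmx_delta map_delta_mx mul_delta_mx.
Qed.

(** The entry of [Pplus'] at row [(i, k)] and column [(j, l)] is 1 when [i = k] and [j = l], and 0
    otherwise, so two of the four sums collapse. *)
Lemma tensmap_Pplus' m d n (F : {linear 'M[C]_d -> 'M[C]_m})
    (G : {linear 'M[C]_d -> 'M[C]_n}) :
  tensmap F G (Pplus' d) =
    \sum_(i < d) \sum_(j < d) F (delta_mx i j) *t G (delta_mx i j).
Proof.
rewrite /tensmap; apply: eq_bigr => i _; apply: eq_bigr => j _.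
have P' k l : (Pplus' d : 'M[C]_(d * d)) (mxtens_index (i, k)) (mxtens_index (j, l))
    = ((i == k) && (j == l))%:R.
  rewrite summxE (bigD1 i) //= [X in _ + X]big1 ?addr0 => [|a ai]; last first.
    rewrite summxE big1 // => b _.
    by rewrite !ketbra_ket tensmxE !mxE eq_sym (negPf ai) mul0r.
  rewrite summxE (bigD1 j) //= big1 ?addr0 => [|b bj]; last first.
    by rewrite !ketbra_ket tensmxE !mxE [j == b]eq_sym (negPf bj) andbF mul0r.
  by rewrite !ketbra_ket tensmxE !mxE !eqxx mul1r [k == i]eq_sym [l == j]eq_sym.
rewrite (bigD1 i) //= [X in _ + X]big1 ?addr0 => [|k ki]; last first.
  by rewrite big1 // => l _; rewrite P' eq_sym (negPf ki) scale0r.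
rewrite (bigD1 j) //= big1 ?addr0 => [|l lj]; last first.
  by rewrite P' [j == l]eq_sym (negPf lj) andbF scale0r.
by rewrite P' !eqxx scale1r.
Qed.

Lemma mxtrace_delta n (i j : 'I_n) : \tr (delta_mx i j) = (i == j)%:R :> C.
Proof.
rewrite /mxtrace (bigD1 i) //= big1 => [|k ki]; rewrite !mxE ?(negPf ki) //.
by rewrite eqxx addr0.
Qed.

(** Trace preservation makes the trace of the [(i, j)] term equal to 1 on the diagonal and 0 off
    it. *)
Lemma mxtrace_choi m n (L : {linear 'M[C]_m -> 'M[C]_n}) :
  trace_preserving L -> \tr (choi L) = m%:R.
Proof.
move=> Ltr; rewrite /choi tensmap_Pplus' raddf_sum /=.
rewrite -[m in RHS]card_ord -sum1_card natr_sum.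
apply: eq_bigr => i _; rewrite raddf_sum (bigD1 i) //= big1 => [|j ji].
  by rewrite mxtrace_tens Ltr !mxtrace_delta eqxx mulr1 addr0.
by rewrite mxtrace_tens Ltr mxtrace_delta eq_sym (negPf ji) mul0r.
Qed.

(** * The map of the maximally entangled state and its dual *)

Lemma Upsilon_Pplus d (Ups : {linear 'M[C]_d -> 'M[C]_d}) :
  is_Upsilon (Pplus d) Ups -> forall A, Ups A = d%:R^-1 *: A.
Proof.
case=> _ eqP.
have UpsE i j : Ups (delta_mx i j) = d%:R^-1 *: delta_mx i j.
  apply/matrixP => a b.
  have /matrixP/(_ (mxtens_index (a, i)) (mxtens_index (b, j))) := eqP.
  (* The second tensor factor isolates the pair [(i, j)]. This is applied to both sides of the
     defining equation: with [F] the images under [Ups], and with [F] the matrix units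
     themselves. *)
  have sumE (F : 'I_d -> 'I_d -> 'M[C]_d) :
      (\sum_i' \sum_j' (F i' j' *t delta_mx i' j'))
        (mxtens_index (a, i)) (mxtens_index (b, j)) = F i j a b.
    rewrite summxE (bigD1 i) //= [X in _ + X]big1 ?addr0 => [|k ki]; last first.
      rewrite summxE big1 // => l _.
      by rewrite tensmxE !mxE [i == k]eq_sym (negPf ki) mulr0.
    rewrite summxE (bigD1 j) //= big1 ?addr0 => [|l lj]; last first.
      by rewrite tensmxE !mxE [j == l]eq_sym (negPf lj) andbF mulr0.
    by rewrite tensmxE !mxE !eqxx mulr1.
  rewrite tensmap_Pplus' sumE => <-; rewrite [RHS]mxE /Pplus mxE.
  rewrite -(sumE (fun i j => delta_mx i j)); congr (_ * fun_of_matrix _ _ _).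
  by apply: eq_bigr => k _; apply: eq_bigr => l _; rewrite ketbra_ket.
move=> A; rewrite [A]matrix_sum_delta raddf_sum scaler_sumr.
apply: eq_bigr => i _; rewrite raddf_sum scaler_sumr; apply: eq_bigr => j _.
by rewrite [LHS]linearZ /= UpsE !scalerA mulrC.
Qed.

Lemma hs_delta n (A : 'M[C]_n) i j : hs A (delta_mx i j) = (A i j)^*.
Proof.
rewrite /hs mxtrace_mulC -[RHS]addr0 /mxtrace (bigD1 i) //= big1 => [|k ki].
  by rewrite !mxE (bigD1 j) //= big1 => [|l lj]; rewrite !mxE ?(negPf lj) ?eqxx
    ?andbF ?mul0r ?mul1r ?addr0.
by rewrite mxE big1 // => l _; rewrite !mxE (negPf ki) mul0r.
Qed.

(** Pairing against matrix units reads off the entries of [Fd A]; the conjugate appears because [hs]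
    is conjugate-linear on the left. *)
Lemma dual_scale d k (F Fd : {linear 'M[C]_d -> 'M[C]_d}) :
  is_dual F Fd -> (forall A, F A = k *: A) -> forall A, Fd A = k^* *: A.
Proof.
move=> FFd Fk A; apply/matrixP => i j; apply: (can_inj conjCK).
rewrite -hs_delta -FFd Fk mxE rmorphM /= conjCK -hs_delta.
by rewrite /hs -scalemxAr mxtraceZ.
Qed.

(** * Vectorisation of operators and Choi operators of channels *)

(** Column-stacking vectorisation, written as an unnormalised maximally entangled vector when [A] is
    unitary. *)
Definition vec d (A : 'M[C]_d) : 'cV[C]_(d * d) :=
  (1%:M *t A) *m \sum_(i < d) tensv (ket i) (ket i).

Lemma vec_Psi_plus d (A : 'M[C]_d) :
  (1%:M *t A) *m Psi_plus d = (sqrtC d%:R)^-1 *: vec A.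
Proof. by rewrite -scalemxAr. Qed.

Lemma vecM d (A B : 'M[C]_d) : vec (A *m B) = (1%:M *t A) *m vec B.
Proof. by rewrite /vec mulmxA tensmx_mul mul1mx. Qed.

Lemma ketbra_tensv m n (u u' : 'cV[C]_m) (v v' : 'cV[C]_n) :
  ketbra (tensv u v) (tensv u' v') = ketbra u u' *t ketbra v v'.
Proof. by rewrite /ketbra -tensmx_mul -adjmx_tens. Qed.

Lemma mul_tensv m n p q (A : 'M[C]_(m, n)) (B : 'M[C]_(p, q)) u v :
  (A *t B) *m tensv u v = tensv (A *m u) (B *m v).
Proof. exact: (@tensmx_mul C m n p q 1 1). Qed.

Lemma tensvE m n (u : 'cV[C]_m) (v : 'cV[C]_n) i j :
  tensv u v (mxtens_index (i, j)) 0 = u i 0 * v j 0.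
Proof.
rewrite mxE mxtens_indexK.
(* The column index lies in ['I_(1 * 1)] and splits into two elements of ['I_1], both 0. *)
by congr (u i _ * v j _); rewrite [LHS]ord1.
Qed.

Lemma vecE d (A : 'M[C]_d) i j : vec A (mxtens_index (i, j)) 0 = A j i.
Proof.
rewrite /vec mulmx_sumr summxE (bigD1 i) //= big1 ?addr0 => [|k ki].
  by rewrite mul_tensv mul1mx tensvE -colE !mxE !eqxx mul1r.
by rewrite mul_tensv mul1mx tensvE mxE eq_sym (negPf ki) mul0r.
Qed.

(** The rank-one form gives both the positivity of [Pplus'] and the Choi operators of unitary
    channels. *)
Lemma ketbra_vec1 d : ketbra (vec 1%:M) (vec 1%:M) = Pplus' d :> 'M[C]_(d * d).
Proof.
rewrite /ketbra /vec adjmxM mulmxA -[_ *m _ *m adjmx _]mulmxA.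
have -> : 1%:M *t 1%:M = 1%:M :> 'M[C]_(d * d).
  apply/matrixP => a b; case: (mxtens_indexP a) => a1 a2.
  case: (mxtens_indexP b) => b1 b2; rewrite tensmxE !mxE -natrM mulnb.
  by rewrite (can_eq (@mxtens_indexK _ _)) xpair_eqE.
rewrite adjmx1 mulmx1 mul1mx adjmx_sum mulmx_suml; apply: eq_bigr => i _.
rewrite mulmx_sumr; apply: eq_bigr => j _.
exact: ketbra_tensv.
Qed.

(** Both sides sum the products of [(A j i)^*] and [B j i]. Overlaps of maximally entangled vectors
    thus become Hilbert-Schmidt products. *)
Lemma braket_vec d (A B : 'M[C]_d) : braket (vec A) (vec B) = hs A B.
Proof.
rewrite /braket mxE sum_mxtens; apply: eq_bigr => i _; rewrite mxE.
by apply: eq_bigr => j _; rewrite !adjmxE !vecE.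
Qed.

Lemma choi_conj d (U : 'M[C]_d) :
  choi (conj_map U) = ketbra (vec U) (vec U).
Proof.
rewrite /choi tensmap_conj -ketbra_vec1 -[U in RHS]mulmx1 vecM.
by rewrite /ketbra (adjmxM (1%:M *t U)) !mulmxA.
Qed.

Lemma conj_channel d (U : 'M[C]_d) : U \is unitarymx -> is_channel (conj_map U).
Proof.
move=> /unitary_adjmxM UU; split=> [k X X_ge0|X].
  by rewrite tensmap_conj -{1}[1%:M *t U]adjmxK; apply: positive_conj.
by rewrite /= mxtrace_mulC mulmxA UU mul1mx.
Qed.

(** Complete positivity is applied with an ancilla of the input dimension, to the positive operator
    [Pplus']. *)
Lemma choi_channel_ge0 m n (L : {linear 'M[C]_m -> 'M[C]_n}) :
  is_channel L -> positive_op (choi L).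
Proof. by case=> L_cp _; apply: L_cp; rewrite -ketbra_vec1; apply: positive_ketbra. Qed.

Lemma hs_unitary d (U : 'M[C]_d) : U \is unitarymx -> hs U U = d%:R.
Proof. by move=> /unitary_adjmxM UU; rewrite /hs UU mxtrace1. Qed.

Lemma hs_conj d (A B : 'M[C]_d) : (hs A B)^* = hs B A.
Proof. by rewrite -!braket_vec braket_conj. Qed.

Lemma hsDr d (A B D : 'M[C]_d) : hs A (B + D) = hs A B + hs A D.
Proof. by rewrite /hs mulmxDr mxtraceD. Qed.

Lemma hsZr d k (A B : 'M[C]_d) : hs A (k *: B) = k * hs A B.
Proof. by rewrite /hs -scalemxAr mxtraceZ. Qed.

Lemma avg_prob_Pplus d (Ups Upsd : {linear 'M[C]_d -> 'M[C]_d}) (X : finType)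
    (E1 E2 : X -> 'M[C]_(d * d)) (x y : X) (u v : 'cV[C]_(d * d))
    (L : {linear 'M[C]_d -> 'M[C]_d}) :
  is_Upsilon (Pplus d) Ups -> is_dual Ups Upsd ->
  E1 x = ketbra u u -> E2 y = ketbra v v ->
  avg_prob (tester Upsd E1 x) (tester Upsd E2 y) L =
    2^-1 * (d%:R^-1 * (braket u (choi L *m u) + braket v (choi L *m v))).
Proof.
move=> /Upsilon_Pplus UpsE /dual_scale/(_ UpsE) UpsdE E1x E2y.
rewrite /avg_prob /tester !(tensmap_scale _ UpsdE) E1x E2y.
(* The dual scales by the conjugate of [d%:R^-1], which is real. *)
rewrite -!scalemxAl !mxtraceZ !mxtrace_ketbraM fmorphV rmorph_nat.
by rewrite -mulrDr -mulrDr.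
Qed.

(** * Unitaries in dimension 2 and the optimal unitary *)

Lemma mxtrace2 (A : 'M[C]_2) : \tr A = A 0 0 + A 1 1.
Proof. by rewrite /mxtrace big_ord_recl big_ord1; congr (_ + A _ _); apply: val_inj. Qed.

(** In dimension 2 the adjugate swaps the diagonal entries and negates the others. *)
Lemma add_adj2 (A : 'M[C]_2) : A + \adj A = (\tr A)%:M.
Proof.
have ord2 (i : 'I_2) : i = 0 \/ i = 1.
  by case: i => [[|[|//]] hi]; [left|right]; apply: val_inj.
have l0 : lift (0 : 'I_2) (0 : 'I_1) = 1 by apply: val_inj.
have l1 : lift (1 : 'I_2) (0 : 'I_1) = 0 by apply: val_inj.
apply/matrixP => i j; rewrite !mxE mxtrace2 /cofactor !det_mx11 !mxE.
by case: (ord2 i) => ->; case: (ord2 j) => ->; rewrite ?l0 ?l1 /=; ring.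
Qed.

(* Cayley-Hamilton gives [W + (\det W) W^* = \tr W], and taking traces forces
   [\det W = 1]. *)
Lemma unitary2_add_adjmx (W : 'M[C]_2) : W \is unitarymx ->
  \tr W != 0 -> \tr W \is Num.real -> W + adjmx W = (\tr W)%:M.
Proof.
move=> Wu t0 t_real.
have adjW : \adj W = \det W *: adjmx W.
  rewrite -[LHS]mul1mx -(unitary_adjmxM Wu) -mulmxA mul_mx_adj.
  by rewrite mul_mx_scalar.
have := add_adj2 W; rewrite adjW => CH.
have /(congr1 mxtrace) := CH.
rewrite mxtraceD mxtraceZ mxtrace_adjmx mxtrace_scalar (CrealP t_real).
rewrite mulr2n => /addrI; rewrite -{2}[\tr W]mul1r => /(mulIf t0) det1.
by rewrite -CH det1 scale1r.
Qed.

Lemma unitary_scale d k (U : 'M[C]_d) :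
  `|k| = 1 -> U \is unitarymx -> k *: U \is unitarymx.
Proof.
move=> k1 /unitaryP UU; apply/unitaryP.
by rewrite adjmxZ -scalemxAl -scalemxAr scalerA UU -normCK k1 expr1n scale1r.
Qed.

(** With [W = V *m adjmx U], the product of [U + V] and its adjoint is [2 + W + adjmx W]; the trace
    of [W] is [hs U V], so this is the scalar [2 + hs U V]. *)
Lemma unitary_add2 (U V : 'M[C]_2) : U \is unitarymx -> V \is unitarymx ->
  0 < hs U V -> (sqrtC (2 + hs U V))^-1 *: (U + V) \is unitarymx.
Proof.
move=> Uu Vu h_gt0; set h := hs U V in h_gt0 *.
have h2_gt0 : 0 < 2 + h by rewrite addr_gt0.
have k_ge0 : 0 <= (sqrtC (2 + h))^-1 by rewrite invr_ge0 sqrtC_ge0 ltW.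
have trW : \tr (V *m adjmx U) = h by rewrite mxtrace_mulC.
have Wu : V *m adjmx U \is unitarymx by rewrite mul_unitarymx ?trmxC_unitary.
have := unitary2_add_adjmx Wu; rewrite trW gt_eqF // gtr0_real // => /(_ isT isT).
rewrite adjmxM adjmxK => WE.
apply/unitaryP; rewrite adjmxZ geC0_conj // -scalemxAl -scalemxAr scalerA.
rewrite adjmxD mulmxDl !mulmxDr (elimT unitaryP Uu) (elimT unitaryP Vu).
have -> : 1%:M + U *m adjmx V + (V *m adjmx U + 1%:M) = (2 + h)%:M.
  rewrite [_ + 1%:M]addrC addrACA [X in _ + X = _]addrC WE.
  by rewrite -!raddfD.
by rewrite -expr2 exprVn sqrtCK scale_scalar_mx mulVf // gt_eqF.
Qed.

(** For a nonzero overlap, aligning the phases gives [hs U1 U] and [hs U2 U] the same squared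
    modulus [2 + |hs U1 U2|]. For a zero overlap the two squares are 4 and 0. *)
Lemma optimal_unitaryP (U1 U2 : 'M[C]_2) : U1 \is unitarymx -> U2 \is unitarymx ->
  let U := optimal_unitary U1 U2 in
  U \is unitarymx /\
  `|hs U1 U| ^+ 2 + `|hs U2 U| ^+ 2 = 4 + 2 * `|hs U1 U2|.
Proof.
move=> U1u U2u; rewrite /optimal_unitary; set h := hs U1 U2.
have h2E : hs U2 U1 = h^* by rewrite hs_conj.
have [h0|h_neq0] := eqVneq h 0.
  split=> //; rewrite h2E h0 rmorph0 normr0 hs_unitary // normr_nat; ring.
have nh_gt0 : 0 < `|h| by rewrite normr_gt0.
have nh_neq0 : `|h| != 0 by rewrite gt_eqF.
pose w := h^* / `|h|; rewrite h2E -/w.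
have wh : w * h = `|h| by rewrite mulrAC [h^* * h]mulrC -normCK expr2 mulfK.
have w1 : `|w| = 1 by rewrite normf_div norm_conjC normr_id divff.
have hV : hs U1 (w *: U2) = `|h| by rewrite hsZr wh.
split.
  by rewrite -hV unitary_add2 // ?unitary_scale // hV.
have k2 : `|(sqrtC (2 + `|h|))^-1| ^+ 2 * (2 + `|h|) = 1.
  rewrite ger0_norm ?invr_ge0 ?sqrtC_ge0 ?addr_ge0 //.
  by rewrite exprVn sqrtCK mulVf // gt_eqF // addr_gt0.
have hw : h^* = w * `|h| by rewrite /w divfK.
(* From here on [w] is an opaque phase, known through [w1], [hV] and [hw]. *)
clearbody w.
have -> : hs U1 ((sqrtC (2 + `|h|))^-1 *: (U1 + w *: U2)) =
    (sqrtC (2 + `|h|))^-1 * (2 + `|h|).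
  by rewrite hsZr hsDr hV hs_unitary.
have -> : hs U2 ((sqrtC (2 + `|h|))^-1 *: (U1 + w *: U2)) =
    w * ((sqrtC (2 + `|h|))^-1 * (2 + `|h|)).
  by rewrite hsZr hsDr h2E hsZr hs_unitary // hw; ring.
rewrite !normrM w1 mul1r [`|2 + `|h| |]ger0_norm ?addr_ge0 //.
set k := `|_^-1| in k2 *; set t := 2 + `|h| in k2 *.
(* Inserting [k ^+ 2 * t = 1] turns the goal into a polynomial identity in [k] and [t]. *)
have -> : 4 + 2 * `|h| = 2 * (k ^+ 2 * t) * t by rewrite k2 /t; ring.
ring.
Qed.

End Operators.


(** * The optimal average probability and its attainment *)

Theorem proposition4 (R : realType)
  (Psi1 Psi2 : 'I_(2 ^ 2) -> 'cV[R[i]]_(2 * 2))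
  (hPsi1 : is_MEB Psi1) (hPsi2 : is_MEB Psi2)
  (X : finType) (Omega1 Omega2 : {set X}) (x1 x2 : 'I_(2 ^ 2) -> X)
  (x1_inj : injective x1) (x2_inj : injective x2)
  (hOmega1 : Omega1 = [set x1 i | i : 'I_(2 ^ 2)])
  (hOmega2 : Omega2 = [set x2 i | i : 'I_(2 ^ 2)])
  (hdisj : Omega1 :&: Omega2 = set0)
  (E1 E2 : X -> 'M[R[i]]_(2 * 2))
  (hE1 : is_povm Omega1 E1) (hE2 : is_povm Omega2 E2)
  (hE1x : forall i, E1 (x1 i) = ketbra (Psi1 i) (Psi1 i))
  (hE2x : forall i, E2 (x2 i) = ketbra (Psi2 i) (Psi2 i))
  (Ups Upsdual : {linear 'M[R[i]]_2 -> 'M[R[i]]_2})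
  (hUps : is_Upsilon (Pplus 2) Ups) (hUpsdual : is_dual Ups Upsdual)
  (U1 U2 : 'I_(2 ^ 2) -> 'M[R[i]]_2)
  (hU1 : forall i, max_entangled_by (U1 i) (Psi1 i))
  (hU2 : forall i, max_entangled_by (U2 i) (Psi2 i))
  (i j : 'I_(2 ^ 2)) :
  let p := avg_prob (tester Upsdual E1 (x1 i)) (tester Upsdual E2 (x2 j)) in
  let c := 2^-1 * (1 + `|braket (Psi1 i) (Psi2 j)|) in
  let U := optimal_unitary (U1 i) (U2 j) in
  is_maximum (@is_channel _ 2 2) p c /\
  U \is unitarymx /\ is_channel (conj_map U) /\ p (conj_map U) = c.
Proof.
have [u1 Psi1E] := hU1 i; have [u2 Psi2E] := hU2 j.
set C : numClosedFieldType := R[i] in Psi1E Psi2E *.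
rewrite vec_Psi_plus in Psi1E; rewrite vec_Psi_plus in Psi2E.
(* The normalisation of [Psi_plus] for [d = 2]; overlaps of the basis vectors are half the
   Hilbert-Schmidt products of their unitaries. *)
pose k : C := (sqrtC 2)^-1.
have k_ge0 : 0 <= k by rewrite invr_ge0 sqrtC_ge0.
have kk : k * k = 2^-1 by rewrite -expr2 exprVn sqrtCK.
have kB (u v : 'cV[C]_(2 * 2)) : braket (k *: u) (k *: v) = 2^-1 * braket u v.
  by rewrite braketZl braketZr geC0_conj // mulrA kk.
have Psi1_unit : braket (Psi1 i) (Psi1 i) = 1.
  by rewrite Psi1E kB braket_vec hs_unitary // mulVf ?pnatr_eq0.
have Psi2_unit : braket (Psi2 j) (Psi2 j) = 1.
  by rewrite Psi2E kB braket_vec hs_unitary // mulVf ?pnatr_eq0.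
have [] := optimal_unitaryP u1 u2.
set U := optimal_unitary _ _ => Uu Uopt.
move=> p c; rewrite -/U.
have pE L : p L = 2^-1 * (2^-1 * (braket (Psi1 i) (choi L *m Psi1 i) +
    braket (Psi2 j) (choi L *m Psi2 j))).
  exact: avg_prob_Pplus hUps hUpsdual (hE1x i) (hE2x j).
have Uc : is_channel (conj_map U) := conj_channel Uu.
have pU : p (conj_map U) = c.
  have bra (V : 'M[C]_2) : braket (k *: vec V) (choi (conj_map U) *m (k *: vec V))
      = 2^-1 * `|hs V U| ^+ 2.
    rewrite -scalemxAr kB choi_conj mul_ketbra braketZr !braket_vec.
    by rewrite normCK hs_conj [hs U V * _]mulrC.
  (* The value is [(4 + 2 * |h|) / 8] with [h] the Hilbert-Schmidt overlap, and the overlap of the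
     two vectors has modulus [|h| / 2]. *)
  rewrite pE Psi1E Psi2E !bra -mulrDr Uopt /c Psi1E Psi2E kB braket_vec.
  rewrite normrM ger0_norm ?invr_ge0 //.
  by field.
split; [split=> [|L Lc]|by []]; first by exists (conj_map U).
rewrite pE /c ler_pM2l ?invr_gt0 // mulrC ler_pdivrMr //.
(* The factor 2 left after clearing denominators is the trace of the Choi operator, which brings the
   goal to the two-vector bound. *)
rewrite -[X in _ * X](mxtrace_choi (proj2 Lc)).
exact: braket_pair_le (choi_channel_ge0 Lc) Psi1_unit Psi2_unit.
Qed.
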